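(* If $(P,\le_P)$ is an infinite computable $\omega$-ordered poset (with $P\subseteq\omega$) which contains no infinite computable chain, then $(P,\le_P)$ contains an infinite $\Delta^0_2$ antichain.
   Context: A poset $(P,\le_P)$ consists of $P\subseteq\omega$ and a reflexive, antisymmetric, transitive relation $\le_P$ on $P$. A chain is a set of pairwise $\le_P$-comparable elements; an antichain is a set of pairwise $\le_P$-incomparable elements. The poset is $\omega$-ordered if for all $x,y\in P$, $x\le_P y$ implies $x\le y$ in the usual order of $\omega$. *)

(* Defs.v *)
From mathcomp Require Import all_boot.
From mathcomp Require Import mathcomp_extra boolp classical_sets cardinality.

Set Implicit Arguments.
Unset Strict Implicit.
Unset Printing Implicit Defensive.

Local Open Scope classical_set_scope.

(** Codes for the n-ary partial recursive functions (Kleene). *)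
Inductive recfun : nat -> Type :=
| Zero : recfun 0
| Succ : recfun 1
| Proj n (i : 'I_n) : recfun n
| Comp k n (f : recfun k) (g : 'I_k -> recfun n) : recfun n
| PRec n (g : recfun n) (h : recfun n.+2) : recfun n.+1
| Mu n (f : recfun n.+1) : recfun n.

(** [eval f v y]: the partial function coded by [f] is defined at [v], with
    value [y].  The recursion argument of [PRec] and the search argument of
    [Mu] come first; [h] receives the counter, the previous value and the
    parameters, in this order.  A search succeeds at [y] only if [f] is defined
    at all earlier arguments. *)
Fixpoint eval n (f : recfun n) : n.-tuple nat -> nat -> Prop :=
  match f in recfun n return n.-tuple nat -> nat -> Prop with
  | Zero => fun _ y => y = 0
  | Succ => fun v y => y = (thead v).+1
  | Proj _ i => fun v y => y = tnth v i
  | Comp k _ f g => fun v y =>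
      exists w : k.-tuple nat, (forall i, eval (g i) v (tnth w i)) /\ eval f w y
  | PRec n g h => fun v =>
      let p : n.-tuple nat := [tuple of behead v] in
      let fix iter_h x y :=
        if x is x'.+1 then
          exists r, iter_h x' r /\ eval h [tuple of x' :: r :: p] y
        else eval g p y in
      iter_h (thead v)
  | Mu _ f => fun v y =>
      eval f [tuple of y :: v] 0 /\
      forall z, z < y -> exists r, eval f [tuple of z :: v] r.+1
  end.

Lemma eval_functional n (f : recfun n) v y z :
  eval f v y -> eval f v z -> y = z.
Proof.
elim: f v y z => {n} [|| n i | k n f IHf g IHg | n g IHg h IHh | n f IHf] v y z.
- by move=> /= -> ->.
- by move=> /= -> ->.
- by move=> /= -> ->.
- move=> /= [w [gw fy]] [w' [gw' fz]].
  have ww' : w = w' by apply: eq_from_tnth => i; exact: IHg (gw i) (gw' i).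
  by rewrite -ww' in fz; exact: IHf fy fz.
- rewrite /=; elim: (thead v) y z => [|x IHx] y z; first exact: IHg.
  move=> [r [xr hy]] [r' [xr' hz]].
  by rewrite -(IHx _ _ xr xr') in hz; exact: IHh hy hz.
- move=> /= [fy ly] [fz lz]; case: (ltngtP y z) => // [yz|zy].
  + by have [r fr] := lz _ yz; have := IHf _ _ _ fy fr.
  + by have [r fr] := ly _ zy; have := IHf _ _ _ fz fr.
Qed.

(** Decidability, by a total recursive characteristic function. *)
Definition computable_rel n (R : n.-tuple nat -> Prop) : Prop :=
  exists c : recfun n,
    forall v, (R v -> eval c v 1) /\ (~ R v -> eval c v 0).

Definition computable_set (A : set nat) : Prop :=
  computable_rel (fun v : 1.-tuple nat => A (nth 0 v 0)).

Definition computable_rel2 (R : nat -> nat -> Prop) : Prop :=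
  computable_rel
    (fun v : 2.-tuple nat => R (nth 0 v 0) (nth 0 v 1)).

Definition computable_rel3 (R : nat -> nat -> nat -> Prop) : Prop :=
  computable_rel
    (fun v : 3.-tuple nat =>
       R (nth 0 v 0) (nth 0 v 1) (nth 0 v 2)).

Definition Sigma02 (A : set nat) : Prop :=
  exists2 R, computable_rel3 R &
    forall x, A x <-> exists y, forall z, R x y z.

Definition Pi02 (A : set nat) : Prop :=
  exists2 R, computable_rel3 R &
    forall x, A x <-> forall y, exists z, R x y z.

Definition Delta02 (A : set nat) : Prop := Sigma02 A /\ Pi02 A.

Record poset := Poset {
  carrier :> set nat;
  ple : nat -> nat -> Prop;
  ple_carrier : forall x y, ple x y -> carrier x /\ carrier y;
  ple_refl : forall x, carrier x -> ple x x;
  ple_anti : forall x y, ple x y -> ple y x -> x = y;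
  ple_trans : forall x y z, ple x y -> ple y z -> ple x z
}.

Definition computable_poset (P : poset) : Prop :=
  computable_set P /\ computable_rel2 (ple P).

Definition omega_ordered (P : poset) : Prop :=
  forall x y, ple P x y -> x <= y.

Definition pcomparable (P : poset) (x y : nat) : Prop := ple P x y \/ ple P y x.

Definition chain (P : poset) (C : set nat) : Prop :=
  C `<=` P /\ forall x y, C x -> C y -> pcomparable P x y.

Definition antichain (P : poset) (A : set nat) : Prop :=
  A `<=` P /\ forall x y, A x -> A y -> x <> y -> ~ pcomparable P x y.

(* Main.v *)
Require Import Defs.
From mathcomp Require Import all_boot.
From mathcomp Require Import mathcomp_extra boolp classical_sets cardinality.

(** The maximal elements of [P] form a [Pi_1] antichain.  If there are only
    finitely many of them, then by omega-orderedness some [a] in [P] lies below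
    none of them, so every element above [a] has a further element strictly
    above it; scanning 0, 1, 2, ... and moving up from [a] greedily then yields
    an infinite computable chain. *)

Set Implicit Arguments.
Unset Strict Implicit.
Unset Printing Implicit Defensive.

Local Open Scope classical_set_scope.

(** * Closure properties of total recursive functions and decidable relations *)

Definition computable_fun n (F : n.-tuple nat -> nat) : Prop :=
  exists c : recfun n, forall v, eval c v (F v).

(** Reduces decidability to computability of the 0-1 characteristic function, so that closure under
    connectives and substitution follows from closure properties of functions. *)
Lemma computable_relE n (R : n.-tuple nat -> Prop) :
  computable_rel R <-> computable_fun (fun v => `[< R v >] : nat).
Proof.
split=> -[c cR]; exists c => v; last first.
  by split=> Rv; have := cR v; [rewrite asboolT | rewrite asboolF].
by have [R1 R0] := cR v; case: asboolP.
Qed.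

Lemma computable_fun_tnth n (i : 'I_n) : computable_fun (fun v => tnth v i).
Proof. by exists (Proj i). Qed.

Lemma computable_fun_comp k n (F : k.-tuple nat -> nat)
    (G : k.-tuple (n.-tuple nat -> nat)) :
  computable_fun F -> (forall i, computable_fun (tnth G i)) ->
  computable_fun (fun v => F [tuple of [seq g v | g <- G]]).
Proof.
move=> [f fF] /choice[g gG]; exists (Comp f g) => v /=.
by exists [tuple of [seq g v | g <- G]]; split=> // i; rewrite tnth_map.
Qed.

Lemma computable_fun_comp1 n (F : 1.-tuple nat -> nat)
    (G : n.-tuple nat -> nat) :
  computable_fun F -> computable_fun G ->
  computable_fun (fun v => F [tuple G v]).
Proof.
move=> cF cG; have [|c Hc] := computable_fun_comp (G := [tuple G]) cF.
  by case=> -[].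
by exists c => v; have := Hc v; congr (eval c v (F _)); exact: val_inj.
Qed.

Lemma computable_fun_comp2 n (F : 2.-tuple nat -> nat)
    (G H : n.-tuple nat -> nat) :
  computable_fun F -> computable_fun G -> computable_fun H ->
  computable_fun (fun v => F [tuple G v; H v]).
Proof.
move=> cF cG cH; have [|c Hc] := computable_fun_comp (G := [tuple G; H]) cF.
  by case=> -[|[]].
by exists c => v; have := Hc v; congr (eval c v (F _)); exact: val_inj.
Qed.

Lemma computable_fun_comp3 n (F : 3.-tuple nat -> nat)
    (G H K : n.-tuple nat -> nat) :
  computable_fun F -> computable_fun G -> computable_fun H ->
  computable_fun K -> computable_fun (fun v => F [tuple G v; H v; K v]).
Proof.
move=> cF cG cH cK.
have [|c Hc] := computable_fun_comp (G := [tuple G; H; K]) cF.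
  by case=> -[|[|[]]].
by exists c => v; have := Hc v; congr (eval c v (F _)); exact: val_inj.
Qed.

Lemma computable_fun_const n a : computable_fun (fun _ : n.-tuple nat => a).
Proof.
elim: a => [|a IHa].
  (* [Zero] has arity 0; composing it with the empty tuple of functions gives the zero function of
     arity [n]. *)
  by have := @computable_fun_comp 0 n (fun=> 0) [tuple]; apply;
    [exists Zero | case].
by apply: (@computable_fun_comp1 n (fun v => (thead v).+1)) IHa; exists Succ.
Qed.

(** Lets a Rocq function be recognized as computable from its two recursion equations, without
    unfolding the semantics of [PRec]. *)
Lemma computable_fun_prec n (G : n.-tuple nat -> nat)
    (H : n.+2.-tuple nat -> nat) (F : nat -> n.-tuple nat -> nat) :
  computable_fun G -> computable_fun H ->
  (forall p, F 0 p = G p) ->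
  (forall x p, F x.+1 p = H [tuple of x :: F x p :: p]) ->
  computable_fun (fun v => F (thead v) [tuple of behead v]).
Proof.
move=> [g gG] [h hH] F0 FS; exists (PRec g h) => v /=.
elim: (thead v) => [|x IHx]; first by rewrite F0.
by exists (F x [tuple of behead v]); split; rewrite ?FS.
Qed.

(** Definition by cases is a primitive recursion on the truth value of the test that ignores its
    previous value: 0 selects the else branch, a successor the then branch. *)
Lemma computable_fun_if n (T : n.-tuple nat -> Prop)
    (F G : n.-tuple nat -> nat) :
  computable_rel T -> computable_fun F -> computable_fun G ->
  computable_fun (fun v => if `[< T v >] then F v else G v).
Proof.
move=> /computable_relE cT cF cG.
pose sel x (p : 2.-tuple nat) := if x is 0 then nth 0 p 1 else nth 0 p 0.
have csel : computable_fun (fun v : 3.-tuple nat =>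
    sel (thead v) [tuple of behead v]).
  (* The base case receives only the two branches, so the else branch has index 1; in the step the
     counter and the previous value come first, so the then branch has index 2. *)
  apply: (@computable_fun_prec 2 (fun v => tnth v (inord 1))
    (fun v => tnth v (inord 2))) => [||p|x p];
    [exact: computable_fun_tnth.. | |];
    by rewrite (tnth_nth 0) inordK.
have [c Hc] := computable_fun_comp3 csel cT cF cG.
by exists c => v; have := Hc v; case: asbool.
Qed.

Lemma computable_rel2_subst n (R : nat -> nat -> Prop)
    (F G : n.-tuple nat -> nat) :
  computable_rel2 R -> computable_fun F -> computable_fun G ->
  computable_rel (fun v => R (F v) (G v)).
Proof.
move=> /computable_relE cR cF cG; apply/computable_relE.
exact: computable_fun_comp2 cR cF cG.
Qed.

Lemma computable_fun_nth n i : i < n ->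
  computable_fun (fun v : n.-tuple nat => nth 0 v i).
Proof.
move=> lt_in; have [c Hc] := computable_fun_tnth (Ordinal lt_in).
by exists c => v; rewrite -(tnth_nth 0 v (Ordinal lt_in)).
Qed.

Lemma computable_rel_and n (R S : n.-tuple nat -> Prop) :
  computable_rel R -> computable_rel S ->
  computable_rel (fun v => R v /\ S v).
Proof.
move=> cR /computable_relE cS; apply/computable_relE.
have [c Hc] := computable_fun_if cR cS (computable_fun_const n 0).
by exists c => v; rewrite asbool_and; have := Hc v; case: asbool.
Qed.

Lemma computable_rel_imply n (R S : n.-tuple nat -> Prop) :
  computable_rel R -> computable_rel S ->
  computable_rel (fun v => R v -> S v).
Proof.
move=> cR /computable_relE cS; apply/computable_relE.
have [c Hc] := computable_fun_if cR cS (computable_fun_const n 1).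
by exists c => v; rewrite asbool_imply; have := Hc v; case: asbool.
Qed.

Lemma infinite_nat_unboundedP (A : set nat) :
  infinite_set A <-> forall N, exists2 x, A x & N <= x.
Proof.
split=> [infA N|unbA /finite_seqP[s As]].
  apply: contrapT => noA; apply: infA.
  apply: sub_finite_set (finite_II N) => x Ax /=.
  by rewrite ltnNge; apply/negP => Nx; apply: noA; exists x.
have [x] := unbA (\max_(y <- s) y).+1; rewrite As /= => xs.
by rewrite ltnNge leq_bigmax_seq.
Qed.

(** * Maximal elements *)

Definition maximal (P : poset) (x : nat) : Prop :=
  carrier P x /\ forall y, ple P x y -> y = x.

Lemma maximal_antichain (P : poset) : antichain P (maximal P).
Proof.
split=> [x []//|x y [_ maxx] [_ maxy] xy [/maxx|/maxy] //].
by move=> e; apply: xy.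
Qed.

Section Maximal.
Variable P : poset.
Hypothesis ple_comp : computable_rel2 (ple P).

(* By antisymmetry [y = x] can be replaced by [ple P y x], and [P x] by
   [ple P x x], so that only the order has to be decided. *)
Lemma maximalE x :
  maximal P x <-> forall y, ple P x x /\ (ple P x y -> ple P y x).
Proof.
split=> [[Px maxx] y|maxx].
  by split=> [|/maxx ->]; exact: ple_refl.
split=> [|y xy]; first by have [/ple_carrier[]] := maxx 0.
by apply: ple_anti (xy); have [_] := maxx y; apply.
Qed.

(** The positions [i] and [j] are left free because the universally quantified variable is the last
    one in the [Sigma02] form and the middle one in the [Pi02] form. *)
Lemma computable_maximal_witness n (i j : nat) : i < n -> j < n ->
  computable_rel (fun v : n.-tuple nat =>
    ple P (nth 0 v i) (nth 0 v i) /\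
    (ple P (nth 0 v i) (nth 0 v j) -> ple P (nth 0 v j) (nth 0 v i))).
Proof.
move=> /computable_fun_nth ci /computable_fun_nth cj.
by apply: computable_rel_and; [|apply: computable_rel_imply];
  exact: computable_rel2_subst.
Qed.

(** By [maximalE] one universal quantifier over a decidable matrix suffices; a vacuous existential
    quantifier, witnessed by 0, is put before it for [Sigma02] and after it for [Pi02]. *)
Lemma Delta02_maximal : Delta02 (maximal P).
Proof.
split.
  exists (fun x _ z => ple P x x /\ (ple P x z -> ple P z x)).
    exact: computable_maximal_witness.
  by move=> x; rewrite maximalE; split=> [|[]//]; exists 0.
exists (fun x y _ => ple P x x /\ (ple P x y -> ple P y x)).
  exact: computable_maximal_witness.
move=> x; rewrite maximalE; split=> maxx y; first by exists 0; exact: maxx.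
by have [] := maxx y.
Qed.

End Maximal.

(** * The greedy chain above [a] *)

Section GreedyChain.
Variables (P : poset) (a : nat).
Hypotheses (Pcomp : computable_rel2 (ple P)) (Pomega : omega_ordered P).
Hypotheses (Pa : carrier P a)
  (noMax : forall x, ple P a x -> exists2 y, ple P x y & y <> x).

(** The element reached once all numbers below [n] have been scanned. Scanning can start at 0
    because, by omega-orderedness, no number below [a] lies above [a] in [P]. *)
Fixpoint greedy n : nat :=
  if n is m.+1 then if `[< ple P (greedy m) m >] then m else greedy m else a.

(** The numbers accepted when scanned. Whether [x] is accepted is settled at stage [x], which is
    what makes the set decidable. *)
Definition greedy_chain : set nat := [set x | ple P (greedy x) x].

Lemma greedy_hit x : greedy_chain x -> greedy x.+1 = x.
Proof. by move=> Cx /=; rewrite asboolT. Qed.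

Lemma greedy_miss x : ~ greedy_chain x -> greedy x.+1 = greedy x.
Proof. by move=> Cx /=; rewrite asboolF. Qed.

Lemma greedy_mono m n : m <= n -> ple P (greedy m) (greedy n).
Proof.
have Pg k : carrier P (greedy k).
  elim: k => [|k IHk] //; have [Ck|Ck] := pselect (greedy_chain k).
    by rewrite greedy_hit //; have [] := ple_carrier Ck.
  by rewrite greedy_miss.
elim: n => [|n IHn]; first by rewrite leqn0 => /eqP ->; exact: ple_refl.
rewrite leq_eqVlt => /predU1P[->|/IHn mn]; first exact: ple_refl.
have [Cn|Cn] := pselect (greedy_chain n); last by rewrite greedy_miss.
by rewrite greedy_hit //; exact: ple_trans mn Cn.
Qed.

(** Nothing strictly above the current element has already been passed over. After a hit at [n] this
    is omega-orderedness; after a miss the current element is unchanged, and [y = n] would have been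
    a hit. *)
Lemma greedy_above n y : ple P (greedy n) y -> y <> greedy n -> n <= y.
Proof.
elim: n => // n IHn; have [Cn|Cn] := pselect (greedy_chain n).
  by rewrite greedy_hit // ltn_neqAle => /Pomega -> /eqP; rewrite eq_sym => ->.
rewrite greedy_miss // => gy yg; rewrite ltn_neqAle IHn // andbT.
by apply/eqP => ny; apply: Cn; rewrite /greedy_chain /= {2}ny.
Qed.

Lemma greedy_chain_chain : chain P greedy_chain.
Proof.
have lt_ple x y : greedy_chain x -> greedy_chain y -> x < y -> ple P x y.
  (* The scan stands at [x] at stage [x.+1], only climbs until stage [y], and then accepts [y]. *)
  move=> Cx Cy xy; rewrite -(greedy_hit Cx).
  exact: ple_trans (greedy_mono xy) Cy.
split=> [x /ple_carrier[]//|x y Cx Cy].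
case: (ltngtP x y) => [xy|yx|<-]; [left|right|left].
- exact: lt_ple.
- exact: lt_ple.
- by have [_ Px] := ple_carrier Cx; exact: ple_refl.
Qed.

(** Some [y] lies strictly above [greedy N], and it is still to be scanned. Were there no hit from
    [N] on, the scan would still stand at [greedy N] when it reaches [y], and would accept [y]. *)
Lemma greedy_chain_unbounded N : exists2 x, greedy_chain x & N <= x.
Proof.
have [y gy yg] := noMax (greedy_mono (leq0n N)).
have Ny := greedy_above gy yg.
apply: contrapT => noC.
suff gyN : greedy y = greedy N.
  by apply: noC; exists y => //; rewrite /greedy_chain /= gyN.
rewrite -(subnKC Ny); elim: (y - N) => [|k <-]; first by rewrite addn0.
rewrite addnS greedy_miss // => Ck.
by apply: noC; exists (N + k) => //; exact: leq_addr.
Qed.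

Lemma greedy_chain_computable : computable_set greedy_chain.
Proof.
apply: computable_rel2_subst Pcomp _ (computable_fun_nth _) => //.
suff [c Hc] : computable_fun (fun v : 1.-tuple nat => greedy (thead v)).
  by exists c => v; have := Hc v; rewrite /thead (tnth_nth 0).
(* A recursion without parameters: entry 0 is the counter, that is, the number being scanned, and
   entry 1 is the current element. *)
apply: (@computable_fun_prec 0 (fun=> a) (fun v : 2.-tuple nat =>
  if `[< ple P (nth 0 v 1) (nth 0 v 0) >] then nth 0 v 0 else nth 0 v 1)
  (fun n _ => greedy n)) => //; first exact: computable_fun_const.
by apply: computable_fun_if; [apply: computable_rel2_subst Pcomp _ _| |];
  exact: computable_fun_nth.
Qed.

End GreedyChain.

Theorem theorem3 (P : poset) (Pinf : infinite_set P)
    (Pcomp : computable_poset P) (Pomega : omega_ordered P)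
    (nochain : ~ exists C : set nat,
        [/\ chain P C, infinite_set C & computable_set C]) :
  exists A : set nat, [/\ antichain P A, infinite_set A & Delta02 A].
Proof.
have [_ cple] := Pcomp; exists (maximal P).
split; [exact: maximal_antichain| |exact: Delta02_maximal].
apply: contrapT => /infinite_nat_unboundedP/existsNP[N noM]; apply: nochain.
have /infinite_nat_unboundedP /(_ N) [a Pa Na] := Pinf.
(* By omega-orderedness everything above [a] is at least [a], hence at least [N], where no maximal
   elements remain. *)
have noMax x : ple P a x -> exists2 y, ple P x y & y <> x.
  move=> ax; apply: contrapT => noy; apply: noM.
  exists x; last exact: leq_trans Na (Pomega _ _ ax).
  split=> [|y xy]; first by have [] := ple_carrier ax.
  by apply: contrapT => yx; apply: noy; exists y.
exists (greedy_chain P a); split.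
- exact: greedy_chain_chain.
- by apply/infinite_nat_unboundedP; exact: greedy_chain_unbounded.
- exact: greedy_chain_computable.
Qed.
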